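(* For a non-empty $\sigma$-compact metric space $K$, we have $$\dim_{tH}K\le\mathcal{I}_c(K).$$
   Context: For a metric space $K$, a point $x\in K$ is called a trivial point of $K$ if $\{x\}$ is a connected component of $K$; $\Lambda(K)$ denotes the collection of trivial points of $K$. The connectedness index of $K$ is $\mathcal{I}_c(K):=\dim_H(K\setminus\Lambda(K))$, where $\dim_H$ denotes the Hausdorff dimension. The topological Hausdorff dimension of a metric space $X$ is $$\dim_{tH}X=\inf_{\mathcal{U}\text{ is a basis of }X}\Bigl(1+\sup_{U\in\mathcal{U}}\dim_H\partial U\Bigr),$$ where $\mathcal{U}$ ranges over the bases of the topology of $X$ and $\dim_H\partial U$ is the Hausdorff dimension of the boundary of $U$, with the convention (adopted in this definition) that $\dim_{tH}\emptyset=\dim_H\emptyset=-1$. *)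

(* Defs.v *)
From HB Require Import structures.
From mathcomp Require Import all_boot all_order all_algebra.
From mathcomp Require Import all_classical all_reals all_analysis.

Set Implicit Arguments.
Unset Strict Implicit.
Unset Printing Implicit Defensive.

Import Order.TTheory GRing.Theory Num.Theory.

Local Open Scope classical_set_scope.
Local Open Scope ring_scope.
Local Open Scope ereal_scope.

Definition boundary (T : topologicalType) (A : set T) : set T :=
  closure A `\` interior A.

Definition sigma_compact (T : topologicalType) : Prop :=
  exists2 F : nat -> set T,
    forall n, compact (F n) & \bigcup_n F n = [set: T].

Definition trivial_points (T : topologicalType) : set T :=
  [set x | connected_component [set: T] x = [set x]].

Section hausdorff.
Context {R : realType} {X : metricType R}.

(* The supremum of no distances is -oo, so this is the usual diameter only for
   nonempty A; [diam_pow] and [hausdorff_content] are insensitive to that. *)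
Definition diam (A : set X) : \bar R :=
  ereal_sup [set (mdist x y)%:E | x in A & y in A].

(* (diam A)^s, where 0^0 = 1 for nonempty A, and the empty set counts for 0
   for every s, including s = 0. *)
Definition diam_pow (s : R) (A : set X) : \bar R :=
  if A == set0 then 0 else diam A `^ s.

(* H^s_delta. Sequences of sets may contain empty sets, so finite covers are
   included; covering by subsets of the ambient space X rather than of A gives
   the same value, since intersecting with A does not increase diameters. *)
Definition hausdorff_content (s delta : R) (A : set X) : \bar R :=
  ereal_inf [set \sum_(0 <= i <oo) diam_pow s (U i) | U in
    [set U : nat -> set X |
      A `<=` \bigcup_i U i /\ forall i, diam (U i) <= delta%:E]].

Definition hausdorff_measure (s : R) (A : set X) : \bar R :=
  ereal_sup [set hausdorff_content s delta A | delta in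
    [set delta : R | (0 < delta)%R]].

(* With this definition the empty set has dimension 0. *)
Definition hausdorff_dim (A : set X) : \bar R :=
  ereal_inf [set s%:E | s in
    [set s : R | (0 <= s)%R /\ hausdorff_measure s A = 0]].

(* Hausdorff dimension with the convention dim_H set0 = -1, which is used
   only in the topological Hausdorff dimension. *)
Definition hausdorff_dimN1 (A : set X) : \bar R :=
  if A == set0 then (-1)%:E else hausdorff_dim A.

End hausdorff.

Definition topological_hausdorff_dim {R : realType} (X : metricType R) :
    \bar R :=
  if [set: X] == set0 then (-1)%:E else
  ereal_inf [set 1 + ereal_sup [set hausdorff_dimN1 (boundary U) | U in B] |
    B in [set B : set (set X) | basis B]].

(* Here dim_H is the plain Hausdorff dimension, so that the index is 0 when all
   points are trivial. With dim_H set0 = -1 instead, a one-point space, whose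
   topological Hausdorff dimension is 0, would have index -1. *)
Definition connectedness_index {R : realType} (K : metricType R) : \bar R :=
  hausdorff_dim ([set: K] `\` @trivial_points K).

(* Main.v *)
Require Import Defs.
From HB Require Import structures.
From mathcomp Require Import all_boot all_order all_algebra.
From mathcomp Require Import all_classical all_reals all_analysis.
From mathcomp Require Import measurable_realfun lra.

(* Let D be the set of nontrivial points and let H^(t+1)(D) = 0. By Eilenberg's
   inequality almost every sphere S around a given point satisfies
   H^t(D `&` S) = 0, so there is a countable family of such spheres, around a
   dense sequence of centers, that separates any two points. Let A be a G_delta
   set with H^t(A) = 0 containing the intersections of D with these spheres.
   The complement of A is F_sigma, hence a countable union of compact sets, and
   these are totally disconnected: a nontrivial connected set lies in D and
   meets one of the spheres. As in the countable sum theorem for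
   zero-dimensional spaces, every point then has arbitrarily small open
   neighborhoods whose boundary misses the complement of A, i.e. is H^t-null.
   Passing to a G_delta set, which may contain trivial points, is essential:
   the complement of the exceptional subset of D itself need not be
   zero-dimensional. *)

Set Implicit Arguments.
Unset Strict Implicit.
Unset Printing Implicit Defensive.

Import Order.TTheory GRing.Theory Num.Theory.

Local Open Scope classical_set_scope.

(** * Separation of closed sets by open sets *)

Lemma disjoint_open_closure (T : topologicalType) (U V : set T) :
  open V -> U `&` V = set0 -> closure U `&` V = set0.
Proof.
move=> oV UV; apply/disjoints_subset.
have /closure_id -> := open_closedC oV.
exact/closureS/disjoints_subset.
Qed.

(** Normality is used twice: first for [A] and [B], then for [closure U] and [B]. The second use
    makes the closures disjoint. *)
Lemma closed_separation (R : realType) (X : pseudoMetricType R)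
    (A B : set X) : closed A -> closed B -> A `&` B = set0 ->
  exists U V, [/\ open U, open V, A `<=` U, B `<=` V &
    closure U `&` closure V = set0].
Proof.
move=> cA cB AB.
have nX : normal_space X := @pseudometric_normal R X.
have [U [V [oU oV AU BV UV]]] := (@normal_openP R X).1 nX _ _ cA cB AB.
have clUB : closure U `&` B = set0.
  exact: subsetI_eq0 (@subset_refl _ _) BV (disjoint_open_closure oV UV).
have [U' [V' [oU' oV' UU' BV' UV']]] :=
  (@normal_openP R X).1 nX _ _ (@closed_closure _ U) cB clUB.
exists U, V'; split => //; rewrite setIC.
apply: subsetI_eq0 (@subset_refl _ _) UU' _.
by apply: disjoint_open_closure => //; rewrite setIC.
Qed.

Lemma closedD (T : topologicalType) (A U : set T) :
  closed A -> open U -> closed (A `\` U).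
Proof.
by move=> cA oU; rewrite setDE; apply: closedI => //; exact: open_closedC.
Qed.

(** * Relatively clopen sets and quasicomponents of compact sets *)

Section relative_clopen.
Context {T : topologicalType}.
Implicit Types A B C : set T.

(** For closed [B] this is clopenness in the subspace [B], phrased by closed sets of the ambient
    space so that no subspace topology is needed. *)
Definition relclopen B C := [/\ C `<=` B, closed C & closed (B `\` C)].

Lemma relclopenI B C C' :
  relclopen B C -> relclopen B C' -> relclopen B (C `&` C').
Proof.
move=> [CB cC cBC] [CB' cC' cBC']; split; first by move=> x [/CB].
- exact: closedI.
- by rewrite setDIr; exact: closedU.
Qed.

Lemma relclopenU B C C' :
  relclopen B C -> relclopen B C' -> relclopen B (C `|` C').
Proof.
move=> [CB cC cBC] [CB' cC' cBC']; split; first by move=> x [/CB|/CB'].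
- exact: closedU.
- by rewrite setDUr; exact: closedI.
Qed.

Lemma relclopen_refl B : closed B -> relclopen B B.
Proof. by move=> cB; split => //; rewrite setDv; exact: closed0. Qed.

(** Meaningful for [x] in [B] only: otherwise no relatively clopen set contains [x], and this is the
    whole space. *)
Definition quasicomponent B x :=
  [set y | forall C, relclopen B C -> C x -> C y].

Lemma quasicomponent_sub B x : closed B -> B x -> quasicomponent B x `<=` B.
Proof. by move=> cB Bx y; apply => //; exact: relclopen_refl. Qed.

Lemma closed_quasicomponent B x : closed (quasicomponent B x).
Proof.
rewrite (_ : quasicomponent _ _ =
    \bigcap_(C in [set C | relclopen B C /\ C x]) C); last first.
  apply/seteqP; split => y /= h; first by move=> C [? ?]; exact: h.
  by move=> C BC Cx; exact: h.
by apply: closed_bigI => C [[_ ? _] _].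
Qed.

(** By compactness: if every such [C] left [O], the sets [C] minus [O] would generate a proper
    filter on [B]. A cluster point lies in every closed [C], hence in the quasicomponent and in [O],
    although the filter contains a set disjoint from the open set [O]. *)
Lemma quasicomponent_nbhs B x O : compact B -> closed B -> B x -> open O ->
  quasicomponent B x `<=` O -> exists C, [/\ relclopen B C, C x & C `<=` O].
Proof.
move=> kB cB Bx oO QO; apply: contrapT => /forallNP noC.
pose D := [set C | relclopen B C /\ C x].
pose F := filter_from D (fun C => C `\` O).
have FF : ProperFilter F.
  apply: filter_from_proper.
    apply: filter_from_filter; first by exists B; split=> //; exact: relclopen_refl.
    move=> C C' [BC Cx] [BC' Cx']; exists (C `&` C').
      by split => //; exact: relclopenI.
    by move=> y [[? ?] ?].
  move=> C [BC Cx]; apply: contrapT => nCO; apply: (noC C); split => // y Cy.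
  by apply: contrapT => nOy; apply: nCO; exists y.
have FC C : relclopen B C -> C x -> F C by move=> BC Cx; exists C => // y [].
have [p [Bp Fp]] := kB F FF (FC _ (relclopen_refl cB) Bx).
have Op : O p.
  apply: QO => C BC Cx; have [_ cC _] := BC; apply: cC => U Up.
  exact: Fp (FC _ BC Cx) Up.
have [|y [[_ nOy] Oy]//] := Fp (B `\` O) O _ (open_nbhs_nbhs (conj oO Op)).
by exists B => //; split => //; exact: relclopen_refl.
Qed.

End relative_clopen.

(** A splitting of the quasicomponent into closed pieces [E] and [Q] minus [E] extends to disjoint
    open sets [G] and [H]. Some relatively clopen [C] containing [x] lies in their union, and its
    part on the side of [x] is again relatively clopen, so the whole quasicomponent is on that
    side. *)
Lemma quasicomponent_connected (R : realType) (X : pseudoMetricType R)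
    (B : set X) x : compact B -> closed B -> B x ->
  connected (quasicomponent B x).
Proof.
move=> kB cB Bx E E0 [U oU EU] [F cF EF].
pose Q := quasicomponent B x; rewrite -/Q in EU EF *.
have cQ : closed Q by exact: closed_quasicomponent.
have cE : closed E by rewrite EF; exact: closedI.
have cQE : closed (Q `\` E).
  by rewrite EU setDIr setDv set0U setDE; apply: closedI => //; exact: open_closedC.
have [G [H [oG oH EG QEH GH]]] := (@normal_openP R X).1
  (@pseudometric_normal R X) _ _ cE cQE (setDIK _ _).
have [C [BC Cx CGH]] : exists C, [/\ relclopen B C, C x & C `<=` G `|` H].
  apply: quasicomponent_nbhs => //; first exact: openU.
  move=> y Qy; have [Ey|nEy] := pselect (E y); first by left; exact: EG.
  by right; apply: QEH.
have nGH y : G y -> H y -> False by move=> Gy Hy; rewrite -[False]/(set0 y) -GH.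
(* Stated for a general pair, since [x] may lie in [G] or in [H]. *)
have part (G' H' : set X) : open G' -> open H' -> (forall y, G' y -> H' y -> False) ->
    C `<=` G' `|` H' -> G' x -> Q `<=` G'.
  move=> oG' oH' dj CGH' Gx y Qy.
  suff : (C `&` G') y by case.
  apply: Qy; last by split.
  have [CB cC cBC] := BC; split; first by move=> z [/CB].
  - rewrite (_ : C `&` G' = C `\` H'); first by apply: closedD.
    apply/seteqP; split => z [Cz] Gz; split => //; first by move/(dj _ Gz).
    by have [] := CGH' _ Cz.
  - by rewrite setDIr; apply: closedU => //; apply: closedD.
have Qx : Q x by move=> C' _.
have [Gx|Hx] := CGH _ Cx.
- have QG := part _ _ oG oH nGH CGH Gx.
  apply/seteqP; split => [y|y Qy]; first by rewrite EU => -[].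
  apply: contrapT => nEy; apply: (nGH y) (QG _ Qy) _; exact: QEH.
- have QH : Q `<=` H.
    by apply: (part _ _ oH oG _ _ Hx) => [y Hy Gy|]; [exact: (nGH y)|rewrite setUC].
  have [y Ey] := E0; exfalso; apply: (nGH y (EG _ Ey)); apply: QH.
  by move: Ey; rewrite EU => -[].
Qed.

(** Quasicomponents of [B] are connected, hence singletons, so each point of [B] in [P] lies in a
    relatively clopen set missing [Q]. These sets are stable under finite unions, and compactness of
    the intersection of [B] and [P], in filter form, yields a single one. *)
Lemma relclopen_separation (R : realType) (X : pseudoMetricType R)
    (B P Q : set X) : compact B -> closed B ->
  (forall E, E `<=` B -> connected E -> is_subset1 E) ->
  closed P -> closed Q -> P `&` Q = set0 ->
  exists C, [/\ relclopen B C, B `&` P `<=` C & C `&` Q = set0].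
Proof.
move=> kB cB tdB cP cQ PQ.
pose D := [set C | relclopen B C /\ C `&` Q = set0].
have nbh x : B x -> P x -> exists2 C, D C & C x.
  move=> Bx Px; have [|C [BC Cx CQ]] :=
      quasicomponent_nbhs kB cB Bx (closed_openC cQ).
    have := tdB _ (quasicomponent_sub cB Bx) (quasicomponent_connected kB cB Bx).
    move=> sub1 y Qy; rewrite (sub1 y x)// => Qx.
    by rewrite -[False]/(set0 x) -PQ.
  by exists C => //; split => //; apply/disjoints_subset.
apply: contrapT => /forallNP noC.
pose F := filter_from D (fun C => (B `&` P) `\` C).
have D0 : D set0.
  split; last by rewrite set0I.
  by split => //; [exact: closed0 | rewrite setD0].
have FF : ProperFilter F.
  apply: filter_from_proper.
    apply: filter_from_filter; first by exists set0.
    move=> C C' [BC CQ] [BC' CQ']; exists (C `|` C').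
      by split; [exact: relclopenU|rewrite setIUl CQ CQ' setU0].
    by move=> y [BPy] /not_orP[].
  move=> C [BC CQ]; apply: contrapT => nCP; apply: (noC C); split => // y BPy.
  by apply: contrapT => nCy; apply: nCP; exists y.
have [|p [[Bp Pp] Fp]] := compact_closedI kB cP FF; first by exists set0 => // y [].
have [C DC Cp] := nbh _ Bp Pp.
have [[CB cC cBC] _] := DC.
have [||y [[[By Py] nCy] nBCy]] := Fp ((B `&` P) `\` C) (~` (B `\` C)).
- by exists C.
- by apply: open_nbhs_nbhs; split; [exact: closed_openC|case].
- exact: nBCy.
Qed.

(** * Open sets whose boundary avoids a countable union of compact totally disconnected sets *)

Lemma boundary_avoid (T : topologicalType) (U V : set T) :
  open U -> open V -> U `&` V = set0 -> boundary U `<=` ~` (U `|` V).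
Proof.
move=> oU oV UV y [clUy nUy] [Uy|Vy].
  by apply: nUy; move/interior_id: oU => ->.
by rewrite -[False]/(set0 y) -(disjoint_open_closure oV UV).
Qed.

(* Two disjoint open sets absorb the compact sets [B n] one after the other, as
   in the countable sum theorem. *)
Lemma sigma_compact_separation (R : realType) (X : pseudoMetricType R)
    (B : nat -> set X) (P Q : set X) :
  (forall n, compact (B n)) -> (forall n, closed (B n)) ->
  (forall n E, E `<=` B n -> connected E -> is_subset1 E) ->
  closed P -> closed Q -> P `&` Q = set0 ->
  exists U, [/\ open U, P `<=` U, U `&` Q = set0 &
    boundary U `&` \bigcup_n B n = set0].
Proof.
move=> kB cB tdB cP cQ PQ.
(* Disjoint closures, not just disjoint sets, are what lets the next compact set be split between
   the two sides. *)
pose inv (W : set X * set X) :=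
  [/\ open W.1, open W.2 & closure W.1 `&` closure W.2 = set0].
(* The invariant stands under the existential so that [choice] gives a total function. *)
have step n W : exists W', inv W -> [/\ inv W', W.1 `<=` W'.1, W.2 `<=` W'.2 &
    B n `<=` W'.1 `|` W'.2].
  have [[oU oV UV]|nW] := pselect (inv W); last by exists W.
  have [C [[CB cC cBC] BUC CV]] := relclopen_separation (kB n) (cB n) (tdB n)
    (@closed_closure _ W.1) (@closed_closure _ W.2) UV.
  have [|||U' [V' [oU' oV' UU' VV' UV']]] := @closed_separation R X
      (closure W.1 `|` C) (closure W.2 `|` (B n `\` C)).
  - by apply: closedU => //; exact: closed_closure.
  - by apply: closedU => //; exact: closed_closure.
  - rewrite setIUl !setIUr UV CV setDIK !(set0U, setU0).
    by apply/disjoints_subset => y Uy [By]; apply; exact: BUC.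
  exists (U', V') => _; split => //=.
  - by move=> y Wy; apply: UU'; left; exact: subset_closure.
  - by move=> y Wy; apply: VV'; left; exact: subset_closure.
  - move=> y By; have [Cy|nCy] := pselect (C y); first by left; apply: UU'; right.
    by right; apply: VV'; right.
have [f fP] := choice (fun p : nat * (set X * set X) => step p.1 p.2).
have [U0 [V0 [oU0 oV0 PU0 QV0 UV0]]] := closed_separation cP cQ PQ.
pose W := fix W n := if n is m.+1 then f (m, W m) else (U0, V0).
have invW n : inv (W n) by elim: n => [//|n /(fP (n, W n))[]].
have WS n := fP (n, W n) (invW n).
have mono m n : (m <= n)%N -> (W m).1 `<=` (W n).1 /\ (W m).2 `<=` (W n).2.
  elim: n => [|n ih]; first by rewrite leqn0 => /eqP ->; split.
  rewrite leq_eqVlt => /predU1P[->|/ih[h1 h2]]; first by split.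
  by have [_ h3 h4 _] := WS n; split; [exact: subset_trans h3|exact: subset_trans h4].
have oU : open (\bigcup_n (W n).1).
  by apply: bigcup_open => n _; have [] := invW n.
have oV : open (\bigcup_n (W n).2).
  by apply: bigcup_open => n _; have [] := invW n.
have UV : (\bigcup_n (W n).1) `&` (\bigcup_n (W n).2) = set0.
  apply/seteqP; split => // y [[m _ Wm] [n _ Wn]].
  have [_ _ <-] := invW (maxn m n); split; apply: subset_closure.
    exact: (mono _ _ (leq_maxl m n)).1.
  exact: (mono _ _ (leq_maxr m n)).2.
exists (\bigcup_n (W n).1); split => //.
- by move=> y Py; exists 0%N => //; exact: PU0.
- apply: subsetI_eq0 (@subset_refl _ _) _ UV.
  by move=> y Qy; exists 0%N => //; exact: QV0.
(* [B n] is absorbed at stage [n.+1], so the two disjoint open unions cover every [B n], while the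
   boundary avoids both. *)
- apply: subsetI_eq0 (boundary_avoid oU oV UV) _ (setICl _).
  move=> y [n _ Bny]; have [_ _ _ /(_ _ Bny) [h|h]] := WS n.
    by left; exists n.+1.
  by right; exists n.+1.
Qed.

Local Open Scope ring_scope.
Local Open Scope ereal_scope.

(** * Null sets of Hausdorff measures *)

Section hausdorff_null.
Context {R : realType} {X : metricType R}.
Implicit Types (A U V : set X) (s t e : R).

(** Vanishing of the Hausdorff measure in epsilon form; a single [e] can bound both the diameters
    and the sum because both bounds may be tightened together. *)
Definition hausdorff_null s A := forall e, (0 < e)%R ->
  exists U : nat -> set X, [/\ A `<=` \bigcup_i U i,
    forall i, diam (U i) <= e%:E & \sum_(0 <= i <oo) diam_pow s (U i) <= e%:E].

Lemma diam_pow_ge0 s U : 0 <= diam_pow s U.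
Proof. by rewrite /diam_pow; case: ifP => // _; exact: poweR_ge0. Qed.

Lemma diam_pow0 s : diam_pow s (@set0 X) = 0.
Proof. by rewrite /diam_pow eqxx. Qed.

Lemma hausdorff_content_ge0 s d A : 0 <= hausdorff_content s d A.
Proof.
apply: le_ereal_inf_tmp => _ [U _ <-].
by apply: nneseries_ge0 => n _ _; exact: diam_pow_ge0.
Qed.

Lemma hausdorff_nullP s A : hausdorff_measure s A = 0 <-> hausdorff_null s A.
Proof.
split=> [mA e e0|nA].
  have : hausdorff_content s e A < e%:E.
    apply: (@le_lt_trans _ _ 0); last by rewrite lte_fin.
    by rewrite -mA; apply: ereal_sup_ubound; exists e.
  by move=> /ereal_inf_lt[_ [U [AU dU] <-]] /ltW sU; exists U.
apply/eqP; rewrite eq_le; apply/andP; split.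
  apply: ge_ereal_sup => _ [d d0 <-]; apply/lee_addgt0Pr => e e0; rewrite add0e.
  have m0 : (0 < Num.min d e)%R by rewrite lt_min d0 e0.
  have [U [AU dU sU]] := nA _ m0.
  apply: (@le_trans _ _ (\sum_(0 <= i <oo) diam_pow s (U i))).
    apply: ereal_inf_lbound; exists U => //; split => // i.
    by apply: le_trans (dU i) _; rewrite lee_fin ge_min lexx.
  by apply: le_trans sU _; rewrite lee_fin ge_min lexx orbT.
apply: le_trans (hausdorff_content_ge0 s 1 A) _.
by apply: ereal_sup_ubound; exists 1%R => //=.
Qed.

Lemma hausdorff_nullS s A B : A `<=` B -> hausdorff_null s B -> hausdorff_null s A.
Proof.
move=> AB nB e e0; have [U [BU dU sU]] := nB e e0.
by exists U; split => //; exact: subset_trans BU.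
Qed.

(** For exponent 0 each nonempty covering set counts 1, so a cover of total at most 1/2 has only
    empty members. *)
Lemma hausdorff_null0 A : hausdorff_null 0 A -> A = set0.
Proof.
move=> /(_ (2^-1)%R) []; first by rewrite invr_gt0.
move=> U [AU _ sU]; rewrite -subset0 => x /AU[i _ Uix]; exfalso.
have : 1 <= (2^-1)%:E :> \bar R.
  apply: le_trans sU.
  rewrite (@nneseriesD1 _ _ i)//; last by move=> k _; exact: diam_pow_ge0.
  apply: (@le_trans _ _ (diam_pow 0 (U i))).
    rewrite /diam_pow; case: eqP => [U0|_]; first by rewrite U0 in Uix.
    by rewrite poweRe0.
  by apply: leeDl; apply: nneseries_ge0 => k _ _; exact: diam_pow_ge0.
by rewrite lee_fin leNgt invf_lt1 ?ltr1n.
Qed.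

Lemma hausdorff_null_dim s A : (0 <= s)%R -> hausdorff_null s A ->
  hausdorff_dim A <= s%:E.
Proof.
by move=> s0 /hausdorff_nullP mA; apply: ereal_inf_lbound; exists s.
Qed.

Lemma hausdorff_null_bigcup s (A : nat -> set X) :
  (forall n, hausdorff_null s (A n)) -> hausdorff_null s (\bigcup_n A n).
Proof.
move=> nA e e0.
(* Shares of [e] summing to [e]; the double sequence of covers is then enumerated by a bijection of
   [nat] with [nat * nat]. *)
have en n : (0 < e / (2 ^ n.+1)%:R)%R by rewrite divr_gt0// ltr0n expn_gt0.
have [U UP] := choice (fun n => nA n _ (en n)).
have /card_esym/ppcard_eqP[f] := card_nat2.
exists (fun k => U (f k).1 (f k).2); split.
- move=> x [n _ Anx]; have [/(_ _ Anx)[i _ Ux] _ _] := UP n.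
  have [k _ fk] : exists2 k, setT k & f k = (n, i).
    by have [g] := @surj _ _ _ _ f (n, i) Logic.I; exists g.
  by exists k => //; rewrite fk.
- move=> k; have [_ dU _] := UP (f k).1; apply: le_trans (dU _) _.
  rewrite lee_fin ler_pdivrMr ?ltr0n ?expn_gt0// ler_peMr//; first exact: ltW.
  by rewrite ler1n expn_gt0.
- rewrite nneseries_esumT; last by move=> ?; exact: diam_pow_ge0.
  rewrite (_ : esum _ _ =
      \esum_(p in [set: nat * nat]) diam_pow s (U p.1 p.2)); last first.
    by rewrite [RHS](@reindex_esum _ _ _ setT _ f).
  apply: le_trans (epsilon_trick0 xpredT (ltW e0)).
  rewrite (_ : esum _ _ = \esum_(i in [set: nat])
      \esum_(j in [set: nat]) diam_pow s (U i j)); last first.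
    rewrite esum_esum; last by move=> *; exact: diam_pow_ge0.
    by congr esum; apply/seteqP; split.
  rewrite [leRHS]nneseries_esumT; last by move=> n; rewrite lee_fin ltW.
  apply: le_esum => n _.
  rewrite -nneseries_esumT; last by move=> ?; exact: diam_pow_ge0.
  by have [] := UP n.
Qed.

Lemma diam_fin U e : U !=set0 -> diam U <= e%:E ->
  exists d : R, [/\ (0 <= d)%R, (d <= e)%R, diam U = d%:E &
    forall x y, U x -> U y -> (mdist x y <= d)%R].
Proof.
move=> [u Uu] dU.
have d0 : 0 <= diam U.
  by apply: ereal_sup_ubound; exists u => //; exists u => //; rewrite mdistxx.
have fd : diam U \is a fin_num.
  by rewrite ge0_fin_numE//; exact: le_lt_trans dU (ltry _).
exists (fine (diam U)); rewrite fineK//; split => //.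
- exact: fine_ge0.
- by rewrite -lee_fin fineK.
- move=> x y Ux Uy; rewrite -lee_fin fineK//.
  by apply: ereal_sup_ubound; exists x => //; exists y.
Qed.

Lemma diam_powE s U (d : R) : U !=set0 -> diam U = d%:E -> diam_pow s U = (d `^ s)%:E.
Proof. by move=> /set0P/negbTE U0 dU; rewrite /diam_pow U0 dU. Qed.

End hausdorff_null.

(** * Open enlargements and null G_delta hulls *)

Lemma powR2_ge1 (R : realType) (t : R) : (0 <= t)%R -> (1 <= 2 `^ t :> R)%R.
Proof. by move=> t0; have := @ler_powR _ 2%R (ler1n _ _) _ _ t0; rewrite powRr0. Qed.

(** For positive [d], taking [r] at most [d] costs the factor [2]^ t[; for]d =
    0[the term]e[pays for]r [^ t]. The case [t = 0] is separate because 0^0 = 1. *)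
Lemma powR_enlarge (R : realType) (t d e c : R) :
  (0 <= t)%R -> (0 <= d)%R -> (0 < e)%R -> (0 < c)%R ->
  exists r : R, [/\ (0 < r)%R, (r <= c)%R &
    ((d + r) `^ t <= 2 `^ t * (d `^ t + e))%R].
Proof.
move=> t0 d0 e0 c0.
have two1 : (1 <= 2 `^ t :> R)%R := powR2_ge1 t0.
have [->|tn0] := eqVneq t 0%R.
  by exists c; split => //; rewrite !powRr0 mul1r lerDl ltW.
have [->|dn0] := eqVneq d 0%R.
  have ep : (0 < e `^ t^-1)%R by exact: powR_gt0.
  exists (Num.min c (e `^ t^-1))%R; split.
  - by rewrite lt_min c0.
  - by rewrite ge_min lexx.
  - rewrite add0r powR0// add0r.
    apply: (@le_trans _ _ ((e `^ t^-1) `^ t)%R).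
      apply: ge0_ler_powR => //; rewrite ?nnegrE ?le_min ?(ltW c0) ?(ltW ep)//.
      by rewrite ge_min lexx orbT.
    by rewrite -powRrM mulVf// powRr1 ?(ltW e0)// ler_peMl// ltW.
have dp : (0 < d)%R by rewrite lt_neqAle eq_sym dn0.
exists (Num.min c d); split.
- by rewrite lt_min c0.
- by rewrite ge_min lexx.
- apply: (@le_trans _ _ ((2 * d) `^ t)%R).
    apply: ge0_ler_powR => //; rewrite ?nnegrE.
    + by rewrite addr_ge0// le_min (ltW c0).
    + by rewrite mulr_ge0.
    + by rewrite mulr_natl mulr2n lerD2l ge_min lexx orbT.
  by rewrite powRM// ler_wpM2l ?powR_ge0// lerDl ltW.
Qed.

Section hull.
Context {R : realType} {X : metricType R}.
Implicit Types (A U V : set X) (s t e : R).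

Lemma open_enlargement t U (c e : R) : (0 <= t)%R -> (0 < e)%R -> (0 < c)%R ->
  diam U <= c%:E -> exists V, [/\ open V, U `<=` V, diam V <= (c + c)%:E &
    diam_pow t V <= (2 `^ t)%:E * (diam_pow t U + e%:E)].
Proof.
move=> t0 e0 c0 dU.
have [->|/set0P U0] := eqVneq U set0.
  exists set0; split => //; first exact: open0.
    by apply: ge_ereal_sup => ? [? []].
  by rewrite diam_pow0 add0e -EFinM lee_fin mulr_ge0 ?powR_ge0// ltW.
have [d [d0 dc dE Ud]] := diam_fin U0 dU.
have [r [r0 rc pr]] := powR_enlarge t0 d0 e0 c0.
have r20 : (0 < r / 2)%R by rewrite divr_gt0.
(* Radius [r / 2] makes the diameter grow by at most [r]; interiors are taken to have open sets. *)
pose V := \bigcup_(u in U) (ball u (r / 2))°.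
have UV : U `<=` V.
  by move=> u Uu; exists u => //; exact: nbhsx_ballx.
have dV : diam V <= (d + r)%:E.
  apply: ge_ereal_sup => _ [x [u Uu /interior_subset ux]]
    [y [v Uv /interior_subset vy]] <-.
  move: ux vy; rewrite !ballEmdist/= lee_fin => ux vy.
  have h1 := metric_triangle x u y; have h2 := metric_triangle u v y.
  have := Ud _ _ Uu Uv; rewrite (metric_sym x u) in h1; lra.
have V0 : V !=set0 by case: U0 => u /UV; exists u.
have [d' [d'0 d'd dE' _]] := diam_fin V0 dV.
exists V; split => //.
- by apply: bigcup_open => u _; exact: open_interior.
- by apply: le_trans dV _; rewrite lee_fin lerD.
- rewrite (diam_powE _ V0 dE') (diam_powE _ U0 dE) -EFinD -EFinM lee_fin.
  by apply: le_trans pr; apply: ge0_ler_powR => //; rewrite nnegrE (le_trans d'0).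
Qed.

Lemma hausdorff_null_open t A e : (0 <= t)%R -> hausdorff_null t A -> (0 < e)%R ->
  exists O : set X, [/\ open O, A `<=` O & exists U : nat -> set X,
    [/\ O `<=` \bigcup_i U i, forall i, diam (U i) <= e%:E &
     \sum_(0 <= i <oo) diam_pow t (U i) <= e%:E]].
Proof.
move=> t0 nA e0.
have two1 : (1 <= 2 `^ t :> R)%R := powR2_ge1 t0.
have two0 : (0 < 2 `^ t :> R)%R by exact: lt_le_trans two1.
pose c := (e / (2 `^ t * 2))%R.
have c0 : (0 < c)%R by rewrite divr_gt0// mulr_gt0.
have c2 : ((2 `^ t) * (c + c) = e)%R.
  by rewrite -mulr2n -[(c *+ 2)%R]mulr_natr mulrCA /c divfK// gt_eqF// mulr_gt0.
have ce : (c + c <= e)%R by rewrite -c2 ler_peMl// addr_ge0// ltW.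
have [U [AU dU sU]] := nA _ c0.
have cn n : (0 < c / (2 ^ n.+1)%:R)%R by rewrite divr_gt0// ltr0n expn_gt0.
have [V VP] := choice (fun n => open_enlargement t0 (cn n) c0 (dU n)).
exists (\bigcup_i V i); split.
- by apply: bigcup_open => i _; have [] := VP i.
- by move=> x /AU[i _ Ux]; exists i => //; have [_ + _ _] := VP i; apply.
exists V; split => //.
  by move=> i; have [_ _ h _] := VP i; apply: le_trans h _; rewrite lee_fin.
apply: (@le_trans _ _ (\sum_(0 <= i <oo)
    (2 `^ t)%:E * (diam_pow t (U i) + (c / (2 ^ i.+1)%:R)%:E))).
  apply: lee_nneseries => i _; first by move=> _; exact: diam_pow_ge0.
  by have [] := VP i.
rewrite nneseriesZl; last first.
  by move=> i _; rewrite adde_ge0 ?diam_pow_ge0// lee_fin ltW.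
rewrite -c2 (EFinM (2 `^ t)%R); apply: lee_wpmul2l; first by rewrite lee_fin ltW.
apply: le_trans (@epsilon_trick R (fun i => diam_pow t (U i)) c xpredT _ (ltW c0)) _.
  by move=> i; exact: diam_pow_ge0.
by rewrite EFinD leeD2r.
Qed.

Lemma hausdorff_null_Gdelta t A : (0 <= t)%R -> hausdorff_null t A ->
  exists G : nat -> set X, [/\ forall n, open (G n), A `<=` \bigcap_n G n &
    hausdorff_null t (\bigcap_n G n)].
Proof.
move=> t0 nA.
have n0 n : (0 < n.+1%:R^-1 :> R)%R by [].
have [G GP] := choice (fun n => hausdorff_null_open t0 nA (n0 n)).
exists G; split.
- by move=> n; have [] := GP n.
- by move=> x Ax n _; have [_ + _] := GP n; apply.
- move=> e e0; have [n _ /(_ _ (leqnn _)) ne] :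
      \forall n \near \oo, (n.+1%:R^-1 < e :> R)%R.
    exact: near_infty_natSinv_lt (PosNum e0).
  have [_ _ [U [GU dU sU]]] := GP n; exists U; split.
  + by apply: subset_trans GU; exact: bigcap_inf.
  + by move=> i; apply: le_trans (dU i) _; rewrite lee_fin ltW.
  + by apply: le_trans sU _; rewrite lee_fin ltW.
Qed.

End hull.

(** * Eilenberg's inequality for spheres *)

Section eilenberg.
Context {R : realType} {X : metricType R}.
Implicit Types (A U V : set X) (s t e : R).
Let mu := @lebesgue_measure R.

(** The distance to [x] is 1-Lipschitz, so on a set of diameter [d] it takes values in an interval
    of length [2 * d], and d^t times 2d is 2d^(t+1). *)
Lemma distance_interval t x U e : (0 <= t)%R -> diam U <= e%:E ->
  exists J : set (measurableTypeR R), [/\ measurable J, forall y, U y -> J (mdist x y) &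
    diam_pow t U * mu J <= 2%:E * diam_pow (t + 1) U].
Proof.
move=> t0 dU; have [->|/set0P U0] := eqVneq U set0.
  by exists set0; split => //; rewrite !diam_pow0 mul0e mule0.
have [d [d0 de dE Ud]] := diam_fin U0 dU; have [u Uu] := U0.
exists (`[mdist x u - d, mdist x u + d]%classic)%R; split => //.
- move=> y Uy; rewrite /= in_itv/=.
  have h1 := metric_triangle x y u; have h2 := metric_triangle x u y.
  have h3 := Ud _ _ Uu Uy; have h4 := Ud _ _ Uy Uu.
  apply/andP; split; first by rewrite lerBlDr (le_trans h1)// lerD2l.
  by rewrite (le_trans h2)// lerD2l.
- rewrite !(diam_powE _ U0 dE) /mu lebesgue_measure_itv/= lte_fin.
  rewrite powRD ?powRr1//; last by rewrite gt_eqF// ltr_wpDl.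
  case: ifPn => [_|_]; last by rewrite mule0 -EFinM lee_fin !mulr_ge0 ?powR_ge0.
  rewrite -EFinB -!EFinM lee_fin.
  have -> : (mdist x u + d - (mdist x u - d) = 2 * d)%R.
    by rewrite opprB addrC addrA subrK mulr_natl mulr2n.
  by rewrite mulrCA.
Qed.

Lemma nneseries_small (f : nat -> \bar R) (e : R) N : (forall n, 0 <= f n) ->
  \sum_(0 <= n <oo) f n \is a fin_num -> (0 < e)%R ->
  exists2 n, (N <= n)%N & f n <= e%:E.
Proof.
move=> f0 foo e0; apply: contrapT => /forall2NP noN.
have fe n : (N <= n)%N -> e%:E <= f n.
  by move=> Nn; have [//|/negP] := noN n; rewrite -ltNge => /ltW.
pose S := fine (\sum_(0 <= n <oo) f n).
(* If all terms from [N] on exceeded [e], this many of them would already exceed the total [S]. *)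
have := @nneseries_lim_ge R f xpredT 0%N (N + (Num.truncn (S / e)).+1)%N
  (fun n _ _ => f0 n).
rewrite -(fineK foo) -/S; apply/negP; rewrite -ltNge.
rewrite (big_cat_nat _ (n := N))//= ?leq_addr//.
apply: (@lt_le_trans _ _ (\sum_(N <= i < N + (Num.truncn (S / e)).+1) e%:E)).
  rewrite sumEFin sumr_const_nat addKn lte_fin -mulr_natl -ltr_pdivrMr//.
  exact: truncnS_gt.
rewrite (@le_trans _ _ (\sum_(N <= i < N + (Num.truncn (S / e)).+1) f i))//.
  by rewrite big_nat_cond [leRHS]big_nat_cond lee_sum// => i /andP[/andP[/fe]].
by rewrite leeDr// sume_ge0.
Qed.

(* Eilenberg's inequality for null sets: integrating over [r] the [t]-sums of
   the covering sets met by the sphere of radius [r] gives at most twice the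
   [t + 1]-sum of the whole cover. *)
Lemma hausdorff_null_sphere t A x (a b : R) : (0 <= t)%R ->
  hausdorff_null (t + 1) A -> (a < b)%R ->
  exists r : R, [/\ (a < r)%R, (r < b)%R &
    hausdorff_null t (A `&` [set y | mdist x y = r])].
Proof.
move=> t0 nA ab.
(* Summable bounds for a sequence of covers, so that the sum [G] over all covers still has finite
   integral. *)
have en n : (0 < 1 / (2 ^ n.+1)%:R :> R)%R by rewrite divr_gt0// ltr0n expn_gt0.
have [U UP] := choice (fun n => nA _ (en n)).
have dU n i : diam (U n i) <= (1 / (2 ^ n.+1)%:R)%:E by have [] := UP n.
have [J JP] := choice (fun p : nat * nat => distance_interval x t0 (dU p.1 p.2)).
pose g n i (r : measurableTypeR R) : \bar R :=
  diam_pow t (U n i) * (\1_(J (n, i)) r)%:E.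
pose f n (r : measurableTypeR R) : \bar R := \sum_(0 <= i <oo) g n i r.
pose G (r : measurableTypeR R) : \bar R := \sum_(0 <= n <oo) f n r.
have g0 n i r : 0 <= g n i r by rewrite mule_ge0 ?diam_pow_ge0// lee_fin.
have f0 n r : 0 <= f n r by apply: nneseries_ge0.
have G0 r : 0 <= G r by apply: nneseries_ge0.
have mJ n i : measurable (J (n, i)) by have [] := JP (n, i).
have m1 n i : measurable_fun [set: measurableTypeR R]
    (fun r => (\1_(J (n, i)) r : R)%:E).
  by apply/measurable_EFinP; apply: measurable_indic; exact: mJ.
have mg n i : measurable_fun setT (g n i) :=
  measurable_funeM (diam_pow t (U n i)) (m1 n i).
have mf n : measurable_fun setT (f n) by apply: ge0_emeasurable_sum.
have mG : measurable_fun setT G by apply: ge0_emeasurable_sum.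
have intf n : \int[mu]_r f n r <= 2%:E * (1 / (2 ^ n.+1)%:R)%:E.
  rewrite integral_nneseries//.
  apply: (@le_trans _ _ (\sum_(0 <= i <oo) 2%:E * diam_pow (t + 1) (U n i))).
    apply: lee_nneseries => i _; first by move=> _; exact: integral_ge0.
    rewrite ge0_integralZl//; last exact: diam_pow_ge0.
    rewrite integral_indic//.
    by rewrite setIT; have [] := JP (n, i).
  rewrite nneseriesZl; last by move=> i _; exact: diam_pow_ge0.
  by rewrite lee_wpmul2l//; have [] := UP n.
have intG : \int[mu]_r G r < +oo.
  rewrite integral_nneseries//.
  apply: (@le_lt_trans _ _ (\sum_(0 <= n <oo) 2%:E * (1 / (2 ^ n.+1)%:R)%:E)).
    by apply: lee_nneseries => n _ //; rewrite integral_ge0.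
  rewrite nneseriesZl; last by move=> i _; rewrite lee_fin ltW.
  apply: (@le_lt_trans _ _ (2%:E * 1)); last by rewrite mule1 ltry.
  by rewrite lee_wpmul2l//; exact: epsilon_trick0.
have iG : mu.-integrable setT G.
  apply/integrableP; split => //.
  by under eq_integral do rewrite gee0_abs//.
(* [G] is finite almost everywhere, hence at some [r] of the interval from [a] to [b], which has
   positive measure. *)
have [N [mN N0 GN]] := integrable_ae measurableT iG.
have [r [ar rb Gr]] : exists r, [/\ (a < r)%R, (r < b)%R & G r \is a fin_num].
  apply: contrapT => /forallNP noR.
  have abN : `]a, b[%classic `<=` N.
    move=> r /=; rewrite in_itv/= => /andP[ar rb]; apply: GN => /= Gr.
    by apply: (noR r); split => //; exact: Gr.
  have : mu `]a, b[%classic <= 0.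
    by rewrite -N0; apply: le_measure => //; rewrite inE.
  by rewrite /mu lebesgue_measure_itv/= lte_fin ab -EFinB lee_fin subr_le0 leNgt ab.
exists r; split => // e e0.
have [n0 _ /(_ _ (leqnn _)) ne] : \forall n \near \oo, (n.+1%:R^-1 < e :> R)%R.
  exact: near_infty_natSinv_lt (PosNum e0).
(* Convergence at [r] provides a cover with small sum and index at least [n0]; the large index makes
   its diameters small. *)
have [n n0n fn] := @nneseries_small (f ^~ r) e n0 (f0 ^~ r) Gr e0.
(* Only the sets whose distance interval contains [r] can meet the sphere; the others are replaced
   by the empty set. *)
exists (fun i => if r \in J (n, i) then U n i else set0); split.
- move=> y [Ay yr]; have [/(_ _ Ay)[i _ Uy] _ _] := UP n.
  exists i => //; rewrite ifT// inE -yr.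
  by have [_ + _] := JP (n, i); apply.
- move=> i; case: ifPn => _; last by apply: ge_ereal_sup => ? [? []].
  apply: le_trans (dU n i) _; rewrite lee_fin (le_trans _ (ltW ne))//.
  rewrite div1r lef_pV2 ?posrE ?ltr0n ?expn_gt0// ler_nat.
  by apply: leq_trans (ltnW (ltn_expl _ _)) => //; rewrite ltnS.
- apply: le_trans fn; apply: lee_nneseries => i _.
    by move=> _; exact: diam_pow_ge0.
  rewrite /g indicE; case: ifPn => _; first by rewrite mule1.
  by rewrite diam_pow0 mule0.
Qed.
End eilenberg.

(** * Dense sequences, and spheres met by connected sets *)

Lemma compact_finite_net (R : realType) (X : metricType R) (F : set X) (e : R) :
  compact F -> (0 < e)%R ->
  exists2 D : set X, finite_set D &
    forall x, F x -> exists2 y, D y & (mdist y x < e)%R.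
Proof.
move=> kF e0; apply: contrapT => /forall2NP noD.
pose cov D := [set x : X | exists2 y, D y & (mdist y x < e)%R].
(* Without a finite net this filter is proper; a cluster point [p] contradicts its own one-point
   net. *)
pose H := filter_from (@finite_set X) (fun D => F `\` cov D).
have HH : ProperFilter H.
  apply: filter_from_proper.
    apply: filter_from_filter; first by exists set0.
    move=> D D' fD fD'; exists (D `|` D'); first by rewrite finite_setU.
    move=> x [Fx nx]; split; split => // -[y Dy yx]; apply: nx; exists y => //.
      by left.
    by right.
  move=> D fD; have [//|] := noD D; move=> /existsNP[x /not_implyP[Fx nx]].
  by exists x.
have [|p [Fp Hp]] := kF H HH; first by exists set0 => // x [].
have [||y [[_ ny] py]] := Hp (F `\` cov [set p]) (ball p e).
- by exists [set p].
- exact: nbhsx_ballx.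
- by apply: ny; exists p => //; rewrite ballEmdist in py.
Qed.

Lemma sigma_compact_dense_seq (R : realType) (X : metricType R) :
  [set: X] !=set0 -> sigma_compact X ->
  exists c : nat -> X, forall x (e : R), (0 < e)%R -> exists n, (mdist (c n) x < e)%R.
Proof.
move=> [x0 _] [F kF FT].
have n0 n : (0 < n.+1%:R^-1 :> R)%R by [].
have net (p : nat * nat) : exists D : set X, finite_set D /\
    forall x, F p.1 x -> exists2 y, D y & (mdist y x < p.2.+1%:R^-1)%R.
  by have [D] := compact_finite_net (kF p.1) (n0 p.2); exists D.
have [D DP] := choice net.
have cS : countable (\bigcup_p D p).
  apply: bigcup_countable => // p _; apply: finite_set_countable.
  exact: (DP p).1.
have [g gS] : exists g : nat -> X, \bigcup_p D p `<=` range g.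
  move/countable_injP : cS => [h hinj].
  (* Inverse of the injection [h], with default value [x0] off its image. *)
  exists (fun n => if pselect (exists2 x, (\bigcup_p D p) x & h x = n) is left e
    then sval (cid2 e) else x0) => x Sx.
  exists (h x) => //; case: pselect => [e|]; last by case; exists x.
  by case: cid2 => y /= Sy hy; apply: hinj => //; rewrite inE.
exists g => x e e0.
have [n _ /(_ _ (leqnn _)) ne] : \forall n \near \oo, (n.+1%:R^-1 < e :> R)%R.
  exact: near_infty_natSinv_lt (PosNum e0).
have [m _ Fx] : (\bigcup_n F n) x by rewrite FT.
have [y Dy yx] := (DP (m, n)).2 _ Fx.
have [k _ gk] : range g y by apply: gS; exists (m, n).
by exists k; rewrite gk (lt_trans yx).
Qed.

Lemma connected_nontrivial (T : topologicalType) (E : set T) x y :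
  connected E -> E x -> E y -> x <> y -> E `<=` ~` @trivial_points T.
Proof.
move=> cE Ex Ey xy z Ez tz.
have Ez1 : E `<=` [set z].
  by rewrite -tz; exact: connected_component_max.
by apply: xy; rewrite (Ez1 _ Ex) (Ez1 _ Ey).
Qed.

Lemma open_mdist_lt (R : realType) (X : metricType R) (c : X) (r : R) :
  open [set z | (mdist c z < r)%R].
Proof.
rewrite openE => z /= cz; apply/nbhs_ballP; exists (r - mdist c z)%R => /=.
  by rewrite subr_gt0.
move=> y; rewrite ballEmdist /=; have := metric_triangle c z y; lra.
Qed.

Lemma open_mdist_gt (R : realType) (X : metricType R) (c : X) (r : R) :
  open [set z | (r < mdist c z)%R].
Proof.
rewrite openE => z /= cz; apply/nbhs_ballP; exists (mdist c z - r)%R => /=.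
  by rewrite subr_gt0.
move=> y; rewrite ballEmdist /= (metric_sym z y).
have := metric_triangle c y z; lra.
Qed.

(** If [E] missed the sphere, its part inside would be clopen in [E], nonempty and proper. *)
Lemma connected_sphere (R : realType) (X : metricType R) (E : set X) c x y (r : R) :
  connected E -> E x -> E y -> (mdist c x < r)%R -> (r < mdist c y)%R ->
  exists2 z, E z & mdist c z = r.
Proof.
move=> cE Ex Ey cx cy; apply: contrapT => /forall2NP noz.
have oin : open [set z | (mdist c z < r)%R] by exact: open_mdist_lt.
have oout : open [set z | (r < mdist c z)%R] by exact: open_mdist_gt.
have EE : E `&` [set z | (mdist c z < r)%R] = E.
  apply: cE.
  - by exists x.
  - by exists [set z | (mdist c z < r)%R].
  - exists (~` [set z | (r < mdist c z)%R]); first exact: open_closedC.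
    apply/seteqP; split => z [Ez] /=.
      by move=> h; split => //; apply/negP; rewrite -leNgt ltW.
    move=> /negP; rewrite -leNgt le_eqVlt => /predU1P[h|//].
    by have [//|] := noz z.
have : (E `&` [set z | (mdist c z < r)%R]) y by rewrite EE.
by move=> [_] /=; rewrite ltNge (ltW cy).
Qed.

(** * A basis with null boundaries, and the dimension inequality *)

Lemma null_boundary_basis (R : realType) (K : metricType R) (t : R) :
  [set: K] !=set0 -> sigma_compact K -> (0 <= t)%R ->
  hausdorff_null (t + 1) ([set: K] `\` @trivial_points K) ->
  exists2 B : set (set K), basis B &
    forall U, B U -> hausdorff_null t (boundary U).
Proof.
move=> K0 sK t0 nD; set D := _ `\` _ in nD.
have [c cP] := sigma_compact_dense_seq K0 sK.
(* The [n]-th radius at each center is chosen between 1/(n+1) and 2/(n+1). *)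
have n0 n : (n.+1%:R^-1 < n.+1%:R^-1 + n.+1%:R^-1 :> R)%R by rewrite ltrDl.
have [r rP] := choice (fun p : nat * nat =>
  hausdorff_null_sphere (c p.1) t0 nD (n0 p.2)).
pose A0 := \bigcup_i \bigcup_n (D `&` [set y | mdist (c i) y = r (i, n)]).
have nA0 : hausdorff_null t A0.
  apply: hausdorff_null_bigcup => i; apply: hausdorff_null_bigcup => n.
  by have [] := rP (i, n).
have [G [oG AG nG]] := hausdorff_null_Gdelta t0 nA0.
have [F kF FT] := sK.
(* The compact sets [F m] minus [G n] in a single sequence; indices that code no pair default to
   [(0, 0)]. *)
pose B k := let p : nat * nat := odflt (0, 0)%N (unpickle k) in F p.1 `\` G p.2.
have kB k : compact (B k).
  by rewrite /B setDE; apply: compact_closedI => //; exact: open_closedC.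
have cB k : closed (B k) by apply: compact_closed; [exact: metric_hausdorff|].
have tdB k E : E `<=` B k -> connected E -> is_subset1 E.
  move=> EB cE x y Ex Ey; apply: contrapT => xy.
  have d0 : (0 < mdist x y)%R by rewrite mdist_gt0; exact/eqP.
  have [n _ /(_ _ (leqnn _)) ne] :
      \forall n \near \oo, (n.+1%:R^-1 < mdist x y / 3 :> R)%R.
    by apply: near_infty_natSinv_lt (PosNum _); rewrite divr_gt0.
  (* With a center closer to [x] than 1/(n+1), less than a third of the distance from [x] to [y],
     the sphere has [x] inside and [y] outside. *)
  have [|i ix] := cP x (n.+1%:R^-1)%R; first by [].
  have [r1 r2 _] := rP (i, n).
  have [||z Ez zr] := @connected_sphere R K E (c i) x y (r (i, n)) cE Ex Ey.
  - exact: lt_trans r1.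
  - have := metric_triangle x (c i) y; rewrite (metric_sym x (c i)) => h.
    apply: (lt_le_trans r2) => /=; move: h ix ne.
    by set q := (n.+1%:R^-1)%R; lra.
  have A0z : A0 z.
    exists i => //; exists n => //; split => //; split => //.
    exact: connected_nontrivial cE Ex Ey xy _ Ez.
  by have [_ nGz] := EB _ Ez; apply: nGz; apply: AG A0z _ Logic.I.
have BG : ~` (\bigcup_k B k) `<=` \bigcap_n G n.
  move=> x nBx n _; apply: contrapT => nGx; apply: nBx.
  have [m _ Fx] : (\bigcup_n F n) x by rewrite FT.
  by exists (pickle (m, n)) => //; rewrite /B pickleK.
exists [set U | open U /\ hausdorff_null t (boundary U)]; last by move=> U [].
split; first by move=> U [].
move=> x W; rewrite nbhsE => -[V [oV Vx] VW].
have [|||U [oU xU UV bU]] :=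
    @sigma_compact_separation R K B [set x] (~` V) kB cB tdB.
- by apply: compact_closed; [exact: metric_hausdorff|exact: compact_set1].
- exact: open_closedC.
- by apply/disjoints_subset => y /= ->.
exists U.
  split; last exact: xU.
  split => //; apply: hausdorff_nullS nG; apply: subset_trans BG.
  exact/disjoints_subset.
by apply: subset_trans VW; rewrite -[V]setCK; exact/disjoints_subset.
Qed.

Lemma hausdorff_dimN1_le (R : realType) (X : metricType R) (A : set X) (t : R) :
  (0 <= t)%R -> hausdorff_null t A -> hausdorff_dimN1 A <= t%:E.
Proof.
move=> t0 nA; rewrite /hausdorff_dimN1; case: ifPn => _.
  by rewrite lee_fin (le_trans _ t0)// lerN10.
exact: hausdorff_null_dim.
Qed.

(** Powers of numbers at most 1 decrease in the exponent, hence the cover with diameters at most 1;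
    diameter 0 is treated apart because of 0^0 = 1. *)
Lemma hausdorff_null_le (R : realType) (X : metricType R) (A : set X) (s t : R) :
  (0 <= s)%R -> (s <= t)%R -> hausdorff_null s A -> hausdorff_null t A.
Proof.
move=> s0 st nA e e0.
have m0 : (0 < Num.min 1 e)%R by rewrite lt_min ltr01.
have [U [AU dU sU]] := nA _ m0.
have me : ((Num.min 1 e)%:E <= e%:E)%E by rewrite lee_fin ge_min lexx orbT.
exists U; split => //; first by move=> i; exact: le_trans (dU i) me.
apply: le_trans me; apply: le_trans sU; apply: lee_nneseries => i _.
  by move=> _; exact: diam_pow_ge0.
have [->|/set0P U0] := eqVneq (U i) set0; first by rewrite !diam_pow0.
have [d [d0 d1 dE _]] := diam_fin U0 (dU i).
rewrite !(diam_powE _ U0 dE) lee_fin.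
have [d_0|dn0] := eqVneq d 0%R.
  have [t_0|tn0] := eqVneq t 0%R; last by rewrite d_0 powR0 ?powR_ge0.
  by have -> : s = t by apply/eqP; rewrite eq_le st t_0.
apply: ger_powR => //; rewrite lt_neqAle eq_sym dn0 d0/=.
by rewrite (le_trans d1)// ge_min lexx.
Qed.

Theorem theorem1p2 (R : realType) (K : metricType R)
    (K_nonempty : [set: K] !=set0) (K_sigma_compact : sigma_compact K) :
  topological_hausdorff_dim K <= connectedness_index K.
Proof.
have /set0P/negbTE K0 := K_nonempty.
apply: le_ereal_inf_tmp => _ [s [s0 /hausdorff_nullP nD] <-].
rewrite /topological_hausdorff_dim K0.
(* For [s] at least 1, take [t = s - 1]. *)
have [s1|s1] := leP 1%R s.
  have t0 : (0 <= s - 1)%R by rewrite subr_ge0.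
  have [|B bB nB] := null_boundary_basis K_nonempty K_sigma_compact t0.
    by rewrite subrK.
  apply: (@le_trans _ _ (1 + ereal_sup [set hausdorff_dimN1 (boundary U) | U in B])).
    by apply: ereal_inf_lbound; exists B.
  rewrite -[leRHS](_ : 1 + (s - 1)%:E = _); last by rewrite -EFinD addrC subrK.
  apply: leeD2l; apply: ge_ereal_sup => _ [U BU <-].
  by apply: hausdorff_dimN1_le => //; exact: nB.
(* For [s] below 1 the nontrivial points are null for exponent 1, so [t = 0] applies: the boundaries
   are empty, of dimension -1 by convention, and the bound is 0. *)
have [|B bB nB] := @null_boundary_basis R K 0 K_nonempty K_sigma_compact (lexx _).
  by rewrite add0r; apply: hausdorff_null_le nD => //; exact: ltW.
apply: (@le_trans _ _ (1 + ereal_sup [set hausdorff_dimN1 (boundary U) | U in B])).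
  by apply: ereal_inf_lbound; exists B.
apply: (@le_trans _ _ (1 + (-1)%:E)); last by rewrite -EFinD subrr lee_fin.
apply: leeD2l; apply: ge_ereal_sup => _ [U BU <-].
by rewrite /hausdorff_dimN1 (hausdorff_null0 (nB _ BU)) eqxx.
Qed.
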